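(* Let $p$ be a prime, $t,k$ positive integers, $q=p^t$ and $\Delta=(q^k-1)/(q-1)$. Let $h$ be a positive divisor of $q-1$ such that $3\mid h$, and suppose that $\gcd(k,3(q-1)/h)=2$. Put $a_1=\frac{q-1}{h}$ and $a_2=\frac{q-1}{h}+\frac{q^k-1}{3}$. Then the triple $(q,k,(a_1,a_2))$ satisfies the following conditions: $3\mid(q^k-1)$, $3\nmid\Delta$, $a_1-a_2=\pm\frac{q^k-1}{3}$, and $\gcd(\Delta,a)=2$, where $n=\max\left\{\frac{q^k-1}{\gcd(q^k-1,a_1)},\frac{q^k-1}{\gcd(q^k-1,a_2)}\right\}$ and $a=a_1$ if $n=\frac{q^k-1}{\gcd(q^k-1,a_1)}$, $a=a_2$ otherwise.
   Context: The result compares two sets of numerical conditions on a pair of integers $(a_1,a_2)$ defining a reducible cyclic code over $\mathbb F_q$ with parity-check polynomial $h_{a_1}(x)h_{a_2}(x)$, where $h_a(x)$ is the minimal polynomial over $\mathbb F_q$ of $\gamma^{-a}$ for a fixed primitive element $\gamma$ of $\mathbb F_{q^k}$. Only the numerical conditions written in the claim are involved. *)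

(* Defs.v *)
From mathcomp Require Import all_boot all_order all_algebra.

Set Implicit Arguments.
Unset Strict Implicit.
Unset Printing Implicit Defensive.

(* All quotients taken with %/ below are exact for the arguments at which
   they are used, and q ^ k - 1 is never truncated since 0 < q. *)

Definition Delta (q k : nat) : nat := (q ^ k - 1) %/ (q - 1).

(* The order of gamma ^ a, for gamma a primitive element of the field with
   q ^ k elements. *)
Definition pow_order (q k a : nat) : nat :=
  (q ^ k - 1) %/ gcdn (q ^ k - 1) a.

Definition code_length (q k a1 a2 : nat) : nat :=
  maxn (pow_order q k a1) (pow_order q k a2).

Definition chosen_exponent (q k a1 a2 : nat) : nat :=
  if code_length q k a1 a2 == pow_order q k a1 then a1 else a2.

(* Main.v *)
Require Import Defs.
From mathcomp Require Import all_boot all_order all_algebra.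

(* As q = 1 modulo q - 1, Delta = k modulo every divisor of q - 1, in particular
   modulo 3 and modulo a1.  Since gcd(k, 3 a1) = 2 forces 3 not to divide k, this
   gives gcd(Delta, a1) = gcd(k, a1) = 2.  Finally a2 - a1 = Delta * ((q - 1) / 3),
   so gcd(Delta, a2) = gcd(Delta, a1) and the choice of a is immaterial. *)

Lemma expn_sub1_Delta (q k : nat) : 1 < q -> q ^ k - 1 = Delta q k * (q - 1).
Proof.
move=> q_gt1; rewrite /Delta divnK // !subn1 predn_exp.
exact: dvdn_mulr.
Qed.

(** [Delta q k] is the geometric sum of the [k] powers [q ^ i] with [i < k], each congruent to 1. *)
Lemma Delta_modn (q k d : nat) : 1 < q -> d %| q - 1 -> Delta q k = k %[mod d].
Proof.
move=> q_gt1 d_dvd.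
have q1_gt0 : 0 < q - 1 by rewrite subn_gt0.
have -> : Delta q k = \sum_(i < k) q ^ i.
  by rewrite /Delta !subn1 predn_exp mulKn // -subn1.
have qX_mod (i : nat) : q ^ i = 1 %[mod d].
  have q_mod : q = 1 %[mod d].
    by apply/eqP; rewrite eqn_mod_dvd // ltnW.
  by rewrite -modnXm q_mod modnXm exp1n.
rewrite -modn_summ (eq_bigr (fun=> 1 %% d)) => [|i _]; last exact: qX_mod.
by rewrite modn_summ sum1_card card_ord.
Qed.

Theorem theorem3 (p t k q h a1 a2 : nat)
  (p_prime : prime p) (t_gt0 : 0 < t) (k_gt0 : 0 < k) (q_def : q = p ^ t)
  (h_gt0 : 0 < h) (h_dvd : h %| q - 1) (three_dvd_h : 3 %| h)
  (gcd_hyp : gcdn k ((3 * (q - 1)) %/ h) = 2)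
  (a1_def : a1 = (q - 1) %/ h)
  (a2_def : a2 = (q - 1) %/ h + (q ^ k - 1) %/ 3) :
  [/\ 3 %| q ^ k - 1,
      ~~ (3 %| Delta q k),
      (a1%:Z - a2%:Z = ((q ^ k - 1) %/ 3)%:Z)%R \/
      (a1%:Z - a2%:Z = - ((q ^ k - 1) %/ 3)%:Z)%R
    & gcdn (Delta q k) (chosen_exponent q k a1 a2) = 2].
Proof.
have q_gt1 : 1 < q by rewrite q_def -(exp1n t) ltn_exp2r // prime_gt1.
have three_dvd_q1 : 3 %| q - 1 := dvdn_trans three_dvd_h h_dvd.
have a1_dvd : a1 %| q - 1 by rewrite a1_def dvdn_div.
(* Since [h] divides [q - 1], the quotient in [gcd_hyp] is exactly [3 * a1]. *)
have gcd_k3a1 : gcdn k (3 * a1) = 2 by rewrite a1_def muln_divA.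
have three_ndvd_k : ~~ (3 %| k).
  apply/negP => three_dvd_k.
  have: 3 %| gcdn k (3 * a1) by rewrite dvdn_gcd three_dvd_k dvdn_mulr.
  by rewrite gcd_k3a1.
have gcd_Delta_a1 : gcdn (Delta q k) a1 = 2.
  (* Once [Delta q k] is replaced by [k], the 2 is read back as [gcdn k (3 * a1)]; the factor 3,
     coprime to [k], then drops out. *)
  rewrite -gcdn_modl (Delta_modn q k _ q_gt1 a1_dvd) gcdn_modl -gcd_k3a1.
  by rewrite Gauss_gcdr // coprime_sym prime_coprime.
(* The factor 3 is taken out of [q - 1], so the shift from [a1] to [a2] is a multiple of
   [Delta q k]. *)
have qk1E : (q ^ k - 1) %/ 3 = Delta q k * ((q - 1) %/ 3).
  by rewrite expn_sub1_Delta // muln_divA.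
split.
- by rewrite expn_sub1_Delta // dvdn_mull.
- by rewrite /dvdn (Delta_modn q k _ q_gt1 three_dvd_q1).
(* The sign is minus, as [a2] is [a1] plus the shift. *)
- by right; rewrite a2_def -a1_def PoszD GRing.opprD GRing.addNKr.
- rewrite /chosen_exponent; case: ifP => // _.
  by rewrite a2_def -a1_def qk1E mulnC addnC gcdnMDl.
Qed.
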